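(* Let $(P,\mathcal{F})$ be a coloured poset. Then there is a homotopy equivalence of chain complexes $\mathcal{C}_*(P,\mathcal{F})\simeq\mathcal{S}_*(P,\mathcal{F})$.
   Context: $R$ is a unital commutative ring. A coloured poset $(P,\mathcal{F})$ is a poset $P$ having a unique maximal element $1=1_P$ (so that $x\le 1_P$ for all $x\in P$) together with a covariant functor $\mathcal{F}:P\to R\text{-Mod}$, where $P$ is viewed as a category with a unique morphism $x\to y$ when $x\le y$. Write $\mathcal{F}_x^y=\mathcal{F}(x\le y)$. $\mathcal{S}_k(P,\mathcal{F})=\bigoplus_{x_1\le\cdots\le x_k}\mathcal{F}(x_1)$ for $k>0$, the sum over all multi-sequences $x_1\le\cdots\le x_k$ (repetitions allowed) with all $x_i\in P\setminus\{1\}$; $\mathcal{S}_0=\mathcal{F}(1)$; $\mathcal{S}_k=0$ for $k<0$. An element $\lambda\in\mathcal{F}(x_1)$ of the summand indexed by $x_1\cdots x_k$ is written $\lambda x_1\cdots x_k$. The differential is $d(\lambda x_1\cdots x_k)=\mathcal{F}_{x_1}^{x_2}(\lambda)x_2\cdots x_k-\sum_{i=2}^k(-1)^i\lambda x_1\cdots\widehat{x}_i\cdots x_k$ for $k>1$ and $d(\lambda x)=\mathcal{F}_x^1(\lambda)$ for $k=1$. $\mathcal{C}_*(P,\mathcal{F})\subset\mathcal{S}_*(P,\mathcal{F})$ is the subcomplex (with the restricted differential) with $\mathcal{C}_0=\mathcal{F}(1)$, $\mathcal{C}_k=0$ for $k<0$ and, for $k>0$, only the summands indexed by strictly increasing sequences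 $x_1<\cdots<x_k$ in $P\setminus\{1\}$. *)

(* Defs.v *)
From HB Require Import structures.
From mathcomp Require Import all_boot all_order all_algebra.
From mathcomp Require Import finmap boolp classical_sets functions cardinality fsbigop.

Set Implicit Arguments.
Unset Strict Implicit.
Unset Printing Implicit Defensive.

Import Order.TTheory GRing.Theory.

Local Open Scope classical_set_scope.
Local Open Scope ring_scope.

(* The differential is indexed by its target degree and its source degree is
   written [1 + k], which (unlike [k + 1]) reduces when [k] is a constructor. *)
Record chainComplex (R : pzRingType) := ChainComplex {
  cc_obj :> int -> lmodType R;
  cc_d : forall k : int, {linear cc_obj (1 + k) -> cc_obj k};
  cc_dd : forall (k : int) (x : cc_obj (1 + (1 + k))),
    cc_d k (cc_d (1 + k) x) = 0
}.

Record chainMap (R : pzRingType) (X Y : chainComplex R) := ChainMap {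
  cm_fun :> forall k : int, {linear X k -> Y k};
  cm_comm : forall (k : int) (x : X (1 + k)),
    cm_fun k (cc_d X k x) = cc_d Y k (cm_fun (1 + k) x)
}.

Definition cm_id (R : pzRingType) (X : chainComplex R) : chainMap X X :=
  @ChainMap R X X (fun k => idfun) (fun k x => erefl).

Section ChainMapComp.
Variables (R : pzRingType) (X Y Z : chainComplex R).
Variables (g : chainMap Y Z) (f : chainMap X Y).

Lemma cm_comp_comm (k : int) (x : X (1 + k)) :
  (g k \o f k) (cc_d X k x) = cc_d Z k ((g (1 + k) \o f (1 + k)) x).
Proof. by rewrite /= !cm_comm. Qed.

Definition cm_comp : chainMap X Z :=
  @ChainMap R X Z (fun k => g k \o f k) cm_comp_comm.

End ChainMapComp.

(* Every integer has the form [1 + k], so the equation covers all degrees. *)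
Definition chain_homotopic (R : pzRingType) (X Y : chainComplex R)
    (f g : chainMap X Y) : Prop :=
  exists h : forall k : int, {linear X k -> Y (1 + k)},
    forall (k : int) (x : X (1 + k)),
      f (1 + k) x - g (1 + k) x
      = cc_d Y (1 + k) (h (1 + k) x) + h k (cc_d X k x).

Definition homotopy_equivalent (R : pzRingType) (X Y : chainComplex R) : Prop :=
  exists (f : chainMap X Y) (g : chainMap Y X),
    chain_homotopic (cm_comp g f) (cm_id X)
    /\ chain_homotopic (cm_comp f g) (cm_id Y).

Record submod (R : pzRingType) (V : lmodType R) (W : {pred V})
    (W_closed : submod_closed W) := Submod {
  submod_val :> V;
  submod_valP : submod_val \in W
}.

Section SubmodTheory.
Variables (R : pzRingType) (V : lmodType R) (W : {pred V}).
Hypothesis W_closed : submod_closed W.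

HB.instance Definition _ := [isSub for @submod_val R V W W_closed].
HB.instance Definition _ := [Choice of submod W_closed by <:].
HB.instance Definition _ :=
  GRing.SubChoice_isSubLmodule.Build R V W (submod W_closed) W_closed.

End SubmodTheory.

Record subcomplex (R : pzRingType) (X : chainComplex R) := Subcomplex {
  sc_pred : forall k : int, {pred X k};
  sc_closed : forall k : int, submod_closed (@sc_pred k);
  sc_stable : forall (k : int) (x : X (1 + k)),
    x \in @sc_pred (1 + k) -> cc_d X k x \in @sc_pred k
}.
Arguments sc_pred {R X} W k : rename.

Section RestrictedComplex.
Variables (R : pzRingType) (X : chainComplex R) (W : subcomplex X).

Definition sc_obj (k : int) : lmodType R := submod (sc_closed W k).

Definition sc_d_fun (k : int) (x : sc_obj (1 + k)) : sc_obj k :=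
  @Submod R (X k) (sc_pred W k) (sc_closed W k)
    (cc_d X k (submod_val x)) (sc_stable (submod_valP x)).

Fact sc_d_is_linear (k : int) : linear (@sc_d_fun k).
Proof. by move=> a u v; apply: val_inj; rewrite /= !linearP. Qed.

HB.instance Definition _ (k : int) :=
  GRing.isLinear.Build R (sc_obj (1 + k)) (sc_obj k) *:%R (@sc_d_fun k)
    (@sc_d_is_linear k).

Definition sc_d (k : int) : {linear sc_obj (1 + k) -> sc_obj k} :=
  @sc_d_fun k.

Lemma sc_dd (k : int) (x : sc_obj (1 + (1 + k))) :
  sc_d k (sc_d (1 + k) x) = 0.
Proof. by apply: val_inj; rewrite /= cc_dd. Qed.

Definition restricted_complex : chainComplex R := ChainComplex sc_dd.

End RestrictedComplex.

(* The direct sum of the modules [M i], as finitely supported families. *)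
Record dsum (R : pzRingType) (I : choiceType) (M : I -> lmodType R) := DSum {
  dsum_val :> forall i, M i;
  dsum_fin : finite_set [set i | dsum_val i != 0]
}.

Section DirectSum.
Variables (R : pzRingType) (I : choiceType) (M : I -> lmodType R).
Implicit Types a b c : dsum M.

HB.instance Definition _ := gen_eqMixin (dsum M).
HB.instance Definition _ := gen_choiceMixin (dsum M).

Lemma dsum_ext a b : (forall i, a i = b i) -> a = b.
Proof.
case: a b => [f ff] [g gf] /= fg.
have {}fg : f = g by apply: functional_extensionality_dep.
by subst g; congr DSum; exact: Prop_irrelevance.
Qed.

Fact dsum_zero_fin : finite_set [set i : I | (0 : M i) != 0].
Proof.
by apply: (sub_finite_set (B := set0)) => // i /=; rewrite eqxx.
Qed.

Fact dsum_opp_fin a : finite_set [set i | - a i != 0].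
Proof.
by apply: sub_finite_set (dsum_fin a) => i /=; rewrite oppr_eq0.
Qed.

Fact dsum_add_fin a b : finite_set [set i | a i + b i != 0].
Proof.
apply: (sub_finite_set (B := [set i | a i != 0] `|` [set i | b i != 0])).
  move=> i /= abi; case: (eqVneq (a i) 0) => ai; last by left.
  by right; move: abi; rewrite ai add0r.
by rewrite finite_setU; split; exact: dsum_fin.
Qed.

Fact dsum_scale_fin (r : R) a : finite_set [set i | r *: a i != 0].
Proof.
apply: sub_finite_set (dsum_fin a) => i /=.
by apply: contra_neq => ->; rewrite scaler0.
Qed.

Definition dsum_zero : dsum M := DSum dsum_zero_fin.
Definition dsum_opp a : dsum M := DSum (dsum_opp_fin a).
Definition dsum_add a b : dsum M := DSum (dsum_add_fin a b).
Definition dsum_scale (r : R) a : dsum M := DSum (dsum_scale_fin r a).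

Fact dsum_addA : associative dsum_add.
Proof. by move=> a b c; apply: dsum_ext => i; exact: addrA. Qed.

Fact dsum_addC : commutative dsum_add.
Proof. by move=> a b; apply: dsum_ext => i; exact: addrC. Qed.

Fact dsum_add0 : left_id dsum_zero dsum_add.
Proof. by move=> a; apply: dsum_ext => i; exact: add0r. Qed.

Fact dsum_addN : left_inverse dsum_zero dsum_opp dsum_add.
Proof. by move=> a; apply: dsum_ext => i; exact: addNr. Qed.

HB.instance Definition _ := GRing.isZmodule.Build (dsum M)
  dsum_addA dsum_addC dsum_add0 dsum_addN.

Fact dsum_scaleA (r s : R) a :
  dsum_scale r (dsum_scale s a) = dsum_scale (r * s) a.
Proof. by apply: dsum_ext => i; exact: scalerA. Qed.

Fact dsum_scale1 : left_id 1 dsum_scale.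
Proof. by move=> a; apply: dsum_ext => i; exact: scale1r. Qed.

Fact dsum_scaleDr : right_distributive dsum_scale +%R.
Proof. by move=> r a b; apply: dsum_ext => i; exact: scalerDr. Qed.

Fact dsum_scaleDl a : {morph dsum_scale^~ a : r s / r + s}.
Proof. by move=> r s; apply: dsum_ext => i; exact: scalerDl. Qed.

HB.instance Definition _ := GRing.Zmodule_isLmodule.Build R (dsum M)
  dsum_scaleA dsum_scale1 dsum_scaleDr dsum_scaleDl.

Lemma dsum0E i : (0 : dsum M) i = 0. Proof. by []. Qed.
Lemma dsumDE a b i : (a + b) i = a i + b i. Proof. by []. Qed.
Lemma dsumNE a i : (- a) i = - a i. Proof. by []. Qed.
Lemma dsumZE r a i : (r *: a) i = r *: a i. Proof. by []. Qed.

Definition dsum_inj_fun (i : I) (v : M i) (j : I) : M j :=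
  if i =P j is ReflectT e then ecast j (M j) e v else 0.

Fact dsum_inj_fin i (v : M i) :
  finite_set [set j | dsum_inj_fun v j != 0].
Proof.
apply: (sub_finite_set (B := [set i])) => //= j /=.
by rewrite /dsum_inj_fun; case: eqP => [//|_]; rewrite eqxx.
Qed.

Definition dsum_inj (i : I) (v : M i) : dsum M := DSum (dsum_inj_fin v).

Lemma dsum_injE i (v : M i) : dsum_inj v i = v.
Proof.
rewrite /= /dsum_inj_fun; case: eqP => // e.
by rewrite (eq_irrelevance e erefl).
Qed.

Lemma dsum_inj_neq i j (v : M i) : i != j -> dsum_inj v j = 0.
Proof. by move=> ij; rewrite /= /dsum_inj_fun; case: eqP ij => // ->; rewrite eqxx. Qed.

Fact dsum_inj_is_linear i : linear (@dsum_inj i).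
Proof.
move=> r u v; apply: dsum_ext => j; rewrite dsumDE dsumZE.
case: (eqVneq i j) => [<-|ij]; first by rewrite !dsum_injE.
by rewrite !dsum_inj_neq // scaler0 addr0.
Qed.

HB.instance Definition _ (i : I) :=
  GRing.isLinear.Build R (M i) (dsum M) *:%R (@dsum_inj i)
    (@dsum_inj_is_linear i).

Variables (N : lmodType R) (g : forall i, {linear M i -> N}).

Definition dsum_lift (a : dsum M) : N := \sum_(i \in [set: I]) g i (a i).

Lemma dsum_lift_wide a (A : {fset I}) :
  (forall i, i \notin A -> a i = 0) -> dsum_lift a = \sum_(i <- A) g i (a i).
Proof. by move=> A0; apply: fsbigTE => i /A0 ->; rewrite linear0. Qed.

Lemma dsum_suppE a i : i \notin fset_set [set j | a j != 0] -> a i = 0.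
Proof.
rewrite in_fset_set; last exact: dsum_fin.
by rewrite notin_setE /= => /negP; rewrite negbK => /eqP.
Qed.

Fact dsum_lift_is_linear : linear dsum_lift.
Proof.
move=> r a b; set A := fset_set [set j | a j != 0].
set B := fset_set [set j | b j != 0].
have HA i : i \notin (A `|` B)%fset -> a i = 0.
  by rewrite inE negb_or => /andP[/dsum_suppE].
have HB i : i \notin (A `|` B)%fset -> b i = 0.
  by rewrite inE negb_or => /andP[_ /dsum_suppE].
rewrite (dsum_lift_wide HA) (dsum_lift_wide HB).
rewrite (@dsum_lift_wide (r *: a + b) (A `|` B)%fset); last first.
  by move=> i iAB; rewrite dsumDE dsumZE HA // HB // scaler0 addr0.
rewrite scaler_sumr -big_split /=.
by apply: eq_bigr => i _; rewrite linearP.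
Qed.

HB.instance Definition _ :=
  GRing.isLinear.Build R (dsum M) N *:%R dsum_lift dsum_lift_is_linear.

Lemma dsum_lift_inj i (v : M i) : dsum_lift (dsum_inj v) = g i v.
Proof.
rewrite (@dsum_lift_wide _ [fset i]%fset).
  by rewrite big_seq_fset1 dsum_injE.
by move=> j; rewrite inE eq_sym => /dsum_inj_neq.
Qed.

End DirectSum.

Record posetFunctor (R : pzRingType) (disp : Order.disp_t)
    (P : porderType disp) := PosetFunctor {
  pf_obj :> P -> lmodType R;
  pf_map : forall x y : P, (x <= y)%O -> {linear pf_obj x -> pf_obj y};
  pf_id : forall (x : P) (v : pf_obj x), pf_map (lexx x) v = v;
  pf_comp : forall (x y z : P) (xy : (x <= y)%O) (yz : (y <= z)%O)
    (v : pf_obj x), pf_map (le_trans xy yz) v = pf_map yz (pf_map xy v)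
}.

(* The structure [tPOrderType] provides an element [\top] above all others;
   [cp_disp] only controls the display of notations. *)
Record colouredPoset (R : comPzRingType) := ColouredPoset {
  cp_disp : Order.disp_t;
  cp_poset :> tPOrderType cp_disp;
  cp_functor : posetFunctor R cp_poset
}.

Section SeqOmit.
Variables (T : eqType).
Implicit Types t : seq T.

Definition seq_omit (i : nat) t : seq T := take i t ++ drop i.+1 t.

Lemma seq_omit0 x t : seq_omit 0 (x :: t) = t.
Proof. by rewrite /seq_omit /= drop0. Qed.

Lemma seq_omitS i x t : seq_omit i.+1 (x :: t) = x :: seq_omit i t.
Proof. by []. Qed.

Lemma seq_omit_subseq i t : subseq (seq_omit i t) t.
Proof.
elim: t i => [|x t IH] [|i] //; first by rewrite seq_omit0; exact: subseq_cons.
by rewrite seq_omitS /= eqxx.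
Qed.

Lemma size_seq_omit i t : (i < size t)%N -> size (seq_omit i t) = (size t).-1.
Proof.
elim: t i => [|x t IH] [|i] // it; first by rewrite seq_omit0.
by rewrite seq_omitS /= IH // (ltn_predK (it : (i < size t)%N)).
Qed.

Lemma seq_omit_omit i j t :
  (j <= i)%N -> seq_omit j (seq_omit i.+1 t) = seq_omit i (seq_omit j t).
Proof.
elim: t i j => [|x t IH] [|i] [|j] // ji; rewrite ?seq_omitS ?seq_omit0 //.
by rewrite IH.
Qed.

Lemma seq_omit_tupleP k (t : k.+1.-tuple T) (i : 'I_k.+1) :
  size (seq_omit i t) == k.
Proof. by rewrite size_seq_omit size_tuple. Qed.

Definition tuple_omit k (t : k.+1.-tuple T) (i : 'I_k.+1) : k.-tuple T :=
  Tuple (seq_omit_tupleP t i).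

End SeqOmit.

(* A multichain with [k + 1] terms, all different from [\top], is stored as its
   first term and the tuple of the others: omitting a term other than the first
   then leaves the head unchanged up to conversion, as required to transport
   coefficients. *)
Section Multichains.
Variables (disp : Order.disp_t) (P : tPOrderType disp).

Definition is_mchain k (c : P * k.-tuple P) : bool :=
  path <=%O c.1 c.2 && all (fun x => x != \top%O) (c.1 :: c.2).

Record mchain (k : nat) := MChain {
  mchain_val :> P * k.-tuple P;
  mchain_valP : is_mchain mchain_val
}.

HB.instance Definition _ k := [isSub for @mchain_val k].
HB.instance Definition _ k := [Choice of mchain k by <:].

Definition mc_head k (c : mchain k) : P := (mchain_val c).1.
Definition mc_tail k (c : mchain k) : k.-tuple P := (mchain_val c).2.

Definition mc_strict k (c : mchain k) : bool :=
  path <%O (mc_head c) (mc_tail c).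

Fact mc_behead_subproof k (c : mchain k.+1) :
  is_mchain (thead (mc_tail c), behead_tuple (mc_tail c)).
Proof.
case: c => -[x t]; rewrite /mc_tail /is_mchain /=.
by case/tupleP: t => y t /=; rewrite theadE => /andP[/andP[_ ->] /and3P[_ -> ->]].
Qed.

Definition mc_behead k (c : mchain k.+1) : mchain k :=
  MChain (mc_behead_subproof c).

Fact mc_omit_subproof k (c : mchain k.+1) (i : 'I_k.+1) :
  is_mchain (mc_head c, tuple_omit (mc_tail c) i).
Proof.
case: c => -[x t]; rewrite /mc_head /mc_tail /is_mchain /=.
move=> /andP[pt /andP[-> at_]]; have st := seq_omit_subseq i t.
rewrite (subseq_path le_trans st pt) /=.
by apply/allP => y /(mem_subseq st); exact: (allP at_).
Qed.

Definition mc_omit k (c : mchain k.+1) (i : 'I_k.+1) : mchain k :=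
  MChain (mc_omit_subproof c i).

Lemma mc_head_le k (c : mchain k.+1) : (mc_head c <= mc_head (mc_behead c))%O.
Proof.
case: c => -[x t] p; have /andP[/= xt _] := p.
change (x <= thead t)%O; case/tupleP: t {p} xt => y t /=.
by rewrite theadE => /andP[].
Qed.

Lemma mchain_eq k (c c' : mchain k) :
  mc_head c = mc_head c' -> val (mc_tail c) = val (mc_tail c') -> c = c'.
Proof.
case: c c' => -[x t] p [[x' t'] p'] /= ex et; apply: val_inj => /=.
by congr pair => //; exact: val_inj.
Qed.

Lemma mc_strict_behead k (c : mchain k.+1) :
  mc_strict c -> mc_strict (mc_behead c).
Proof.
case: c => -[x t] p; rewrite /mc_strict.
change (path <%O x t -> path <%O (thead t) (behead t)).
by case/tupleP: t {p} => y t /=; rewrite theadE => /andP[].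
Qed.

Lemma mc_strict_omit k (c : mchain k.+1) (i : 'I_k.+1) :
  mc_strict c -> mc_strict (mc_omit c i).
Proof. by apply: (subseq_path lt_trans); exact: seq_omit_subseq. Qed.

Lemma mc_behead_omit0 k (c : mchain k.+2) :
  mc_behead (mc_omit c ord0) = mc_behead (mc_behead c).
Proof.
case: c => -[x t] p; case/tupleP: t p => y t; case/tupleP: t => z t p.
by apply: mchain_eq; rewrite /mc_head /mc_tail /= ?(tnth_nth x) /= ?seq_omit0.
Qed.

Lemma mc_behead_omitS k (c : mchain k.+2) (i : 'I_k.+1) :
  mc_behead (mc_omit c (lift ord0 i)) = mc_omit (mc_behead c) i.
Proof.
case: c => -[x t] p; case/tupleP: t p => y t; case/tupleP: t => z t p.
by apply: mchain_eq; rewrite /mc_head /mc_tail /= ?(tnth_nth x) /= ?seq_omitS.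
Qed.

Lemma mc_omit_omit k (c : mchain k.+2) (i j : 'I_k.+1) : (j <= i)%N ->
  mc_omit (mc_omit c (lift ord0 i)) j
  = mc_omit (mc_omit c (widen_ord (leqnSn k.+1) j)) i.
Proof. by move=> ji; apply: mchain_eq => //=; exact: seq_omit_omit. Qed.

End Multichains.

Lemma alternating_double_sum0 (R : pzRingType) (V : lmodType R) (n : nat)
    (D : 'I_n.+1 -> 'I_n -> V) :
  (forall i j : 'I_n, (j <= i)%N ->
     D (lift ord0 i) j = D (widen_ord (leqnSn n) j) i) ->
  \sum_(i < n.+1) \sum_(j < n) (-1) ^+ i *: ((-1) ^+ j *: D i j) = 0.
Proof.
move=> HD; pose X (i : 'I_n.+1) (j : 'I_n) := (-1) ^+ i *: ((-1) ^+ j *: D i j).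
rewrite (eq_bigr (fun i : 'I_n.+1 => \sum_(j < n | (j < i)%N) X i j +
   \sum_(j < n | ~~ (j < i)%N) X i j)); last first.
  by move=> i _; rewrite [LHS](bigID (fun j : 'I_n => (j < i)%N)).
rewrite big_split /= big_ord_recl /= [X in X + _ + _]big_pred0 // add0r.
rewrite [X in _ + X]big_ord_recr /= [X in _ + (_ + X)]big1 ?addr0; last first.
  by move=> j; rewrite ltn_ord.
rewrite [X in _ + X](exchange_big_dep xpredT) //= -big_split big1 //= => i _.
rewrite [X in _ + X](eq_bigl (fun j : 'I_n => (j < bump 0 i)%N)); last first.
  by move=> j; rewrite -leqNgt.
rewrite -big_split big1 //= => j ji.
rewrite /X /= -HD // !scalerA /bump leq0n exprD expr1 mulN1r mulNr scaleNr.
by rewrite -!exprD addnC addNr.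
Qed.

Section Complexes.
Variables (R : comPzRingType) (P : colouredPoset R).

Local Notation F := (cp_functor P).

Definition mc_colour k (c : mchain P k) : lmodType R := F (mc_head c).

(* [mchain P k] has sequences of length [k + 1], so [S_sum k] sits in degree
   [k + 1]. *)
Definition S_sum (k : nat) : lmodType R := dsum (@mc_colour k).

(* The differential of [v x_1 ... x_(k+2)]: the ordinal [i] stands for the term
   [x_(i+2)], whence the sign [(-1) ^+ i.+2]. *)
Definition S_face k (c : mchain P k.+1) (v : mc_colour c) : S_sum k :=
  dsum_inj (i := mc_behead c) (pf_map F (mc_head_le c) v)
  - \sum_(i < k.+1) (-1) ^+ i.+2 *: dsum_inj (i := mc_omit c i) v.

Fact S_face_is_linear k (c : mchain P k.+1) : linear (@S_face k c).
Proof.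
move=> r u v; rewrite /S_face.
have E i : dsum_inj (i := mc_omit c i) (r *: u + v : mc_colour _)
    = r *: dsum_inj (i := mc_omit c i) u + dsum_inj (i := mc_omit c i) v
    :> S_sum k by exact: linearP.
rewrite (linearP (pf_map F _)) (linearP (@dsum_inj R _ (@mc_colour k) _)).
rewrite scalerBr addrACA -opprD; congr (_ - _).
rewrite scaler_sumr -big_split /=.
apply: eq_bigr => i _; rewrite E scalerDr !scalerA.
by rewrite commr_sign.
Qed.
HB.instance Definition _ k (c : mchain P k.+1) :=
  GRing.isLinear.Build R (mc_colour c) (S_sum k) *:%R (@S_face k c)
    (@S_face_is_linear k c).

Definition S_dS (k : nat) : {linear S_sum k.+1 -> S_sum k} :=
  dsum_lift (@S_face k : forall c, {linear mc_colour c -> S_sum k}).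

Definition S_d0 : {linear S_sum 0 -> F \top%O} :=
  dsum_lift (fun c : mchain P 0 => pf_map F (lex1 (mc_head c))).

Definition S_obj (k : int) : lmodType R :=
  match k with
  | Posz 0 => F \top%O
  | Posz k.+1 => S_sum k
  | Negz _ => 'rV[R]_0
  end.

Definition S_d (k : int) : {linear S_obj (1 + k) -> S_obj k} :=
  match k return {linear S_obj (1 + k) -> S_obj k} with
  | Posz 0 => S_d0
  | Posz k.+1 => S_dS k
  | Negz _ => \0
  end.

Lemma dsum_inj_map k (c c' : mchain P k) x (v : F x)
    (h : (x <= mc_head c)%O) (h' : (x <= mc_head c')%O) : c = c' ->
  dsum_inj (i := c) (pf_map F h v : mc_colour c)
  = dsum_inj (i := c') (pf_map F h' v : mc_colour c').
Proof. by move=> e; subst c'; rewrite (bool_irrelevance h h'). Qed.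


Lemma S_dS_inj k (c : mchain P k.+1) (v : mc_colour c) :
  S_dS k (dsum_inj v) = S_face v.
Proof. exact: dsum_lift_inj. Qed.

Lemma S_d0_inj (c : mchain P 0) (v : mc_colour c) :
  S_d0 (dsum_inj v) = pf_map F (lex1 (mc_head c)) v.
Proof. exact: dsum_lift_inj. Qed.

Lemma pf_map_comp (x y z : P) (xy : (x <= y)%O) (yz : (y <= z)%O)
    (xz : (x <= z)%O) (v : F x) : pf_map F yz (pf_map F xy v) = pf_map F xz v.
Proof. by rewrite -pf_comp; congr (pf_map _ _ _); exact: bool_irrelevance. Qed.

Lemma S_d0_dS (a : S_sum 1) : S_d0 (S_dS 0 a) = 0.
Proof.
change (S_d0 (\sum_(c \in [set: mchain P 1]) S_face (a c)) = 0).
rewrite linear_sum big1 // => c _; move: (a c) => v.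
rewrite /S_face big_ord_recl big_ord0 addr0 sqrrN expr1n scale1r.
rewrite linearB !S_d0_inj (pf_map_comp _ _ (lex1 (mc_head c))).
apply/eqP; rewrite subr_eq0; apply/eqP.
by congr (pf_map _ _ _); exact: bool_irrelevance.
Qed.

Lemma S_dS_dS k (a : S_sum k.+2) : S_dS k (S_dS k.+1 a) = 0.
Proof.
change (S_dS k (\sum_(c \in [set: mchain P k.+2]) S_face (a c)) = 0).
rewrite linear_sum big1 // => c _; move: (a c) => v.
pose w := pf_map F (mc_head_le c) v.
have sgn n : (-1) ^+ n.+2 = (-1) ^+ n :> R by rewrite exprS exprS mulrA mulrNN !mul1r.
pose D (i : 'I_k.+2) (j : 'I_k.+1) : S_sum k :=
  dsum_inj (i := mc_omit (mc_omit c i) j) v.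
pose B (i : 'I_k.+1) : S_sum k := dsum_inj (i := mc_omit (mc_behead c) i) w.
pose A : S_sum k :=
  dsum_inj (i := mc_behead (mc_behead c)) (pf_map F (mc_head_le _) w).
pose B' (i : 'I_k.+2) : S_sum k :=
  dsum_inj (i := mc_behead (mc_omit c i)) (pf_map F (mc_head_le (mc_omit c i)) v).
have B'0 : B' ord0 = A.
  rewrite /A /w pf_map_comp; first exact: le_trans (mc_head_le _) (mc_head_le _).
  by move=> h; apply: dsum_inj_map; exact: mc_behead_omit0.
have B'S i : B' (lift ord0 i) = B i.
  by apply: dsum_inj_map; exact: mc_behead_omitS.
have -> : S_dS k (S_face v) = (A - \sum_(i < k.+1) (-1) ^+ i *: B i)
  - \sum_(i < k.+2) (-1) ^+ i *: (B' i - \sum_(j < k.+1) (-1) ^+ j *: D i j).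
  rewrite {1}/S_face (linearB (S_dS k)) (linear_sum (S_dS k)) S_dS_inj.
  rewrite {1}/S_face; congr (_ - _ - _).
    by apply: eq_bigr => i _; rewrite sgn.
  apply: eq_bigr => i _; rewrite (linearZZ (S_dS k)) S_dS_inj sgn; congr (_ *: (_ - _)).
  by apply: eq_bigr => j _; rewrite sgn.
under [X in _ - X]eq_bigr do rewrite scalerBr scaler_sumr.
rewrite sumrB alternating_double_sum0 ?subr0; last first.
  move=> i j ji; rewrite /D -[v](pf_id (p := F)).
  by apply: dsum_inj_map; exact: mc_omit_omit.
rewrite [X in _ - X]big_ord_recl expr0 scale1r B'0.
under [X in _ - (_ + X)]eq_bigr => i _ do
  rewrite /= /bump leq0n exprD expr1 mulN1r scaleNr B'S.
by rewrite sumrN subrr.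
Qed.

Lemma S_dd (k : int) (x : S_obj (1 + (1 + k))) : S_d k (S_d (1 + k) x) = 0.
Proof.
case: k x => [[|k]|k] x; [exact: S_d0_dS|exact: S_dS_dS|by []].
Qed.

Definition S_complex : chainComplex R := ChainComplex S_dd.

Definition strict_supp (k : nat) : {pred S_sum k} :=
  fun a => `[< forall c, a c != 0 -> mc_strict c >].

Fact strict_supp_closed (k : nat) : submod_closed (@strict_supp k).
Proof.
split; first by apply/asboolP => c; rewrite eqxx.
move=> r a b /asboolP aP /asboolP bP; apply/asboolP => c.
rewrite dsumDE dsumZE; case: (eqVneq (a c) 0) => [->|/aP //].
by rewrite scaler0 add0r; exact: bP.
Qed.

HB.instance Definition _ k :=
  GRing.isSubmodClosed.Build R (S_sum k) (@strict_supp k)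
    (@strict_supp_closed k).

Lemma strict_supp_inj k (c : mchain P k) (v : mc_colour c) :
  mc_strict c -> dsum_inj v \in @strict_supp k.
Proof.
move=> sc; apply/asboolP => c'; case: (eqVneq c c') => [<- //|cc'].
by rewrite dsum_inj_neq ?eqxx.
Qed.

Lemma strict_supp_d k (a : S_sum k.+1) :
  a \in @strict_supp k.+1 -> S_dS k a \in @strict_supp k.
Proof.
move=> /asboolP aP.
change (\sum_(c \in [set: mchain P k.+1]) S_face (a c) \in @strict_supp k).
apply: rpred_sum => c _; case: (eqVneq (a c) 0) => [->|/aP sc].
  by rewrite linear0 rpred0.
apply: rpredB; first by apply: strict_supp_inj; exact: mc_strict_behead.
apply: rpred_sum => i _; apply: rpredZ.
by apply: strict_supp_inj; exact: mc_strict_omit.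
Qed.

(* In degree [k + 1], the partial sum over strictly increasing sequences; in
   degrees [<= 0], everything. *)
Definition C_pred (k : int) : {pred S_complex k} :=
  match k return {pred S_obj k} with
  | Posz k.+1 => @strict_supp k
  | _ => predT
  end.

Fact C_pred_closed (k : int) : submod_closed (@C_pred k).
Proof. by case: k => [[|k]|k] //; exact: strict_supp_closed. Qed.

Fact C_pred_stable (k : int) (x : S_complex (1 + k)) :
  x \in @C_pred (1 + k) -> cc_d S_complex k x \in @C_pred k.
Proof. by case: k x => [[|k]|k] x //; exact: strict_supp_d. Qed.

Definition C_subcomplex : subcomplex S_complex :=
  Subcomplex C_pred_closed C_pred_stable.

Definition C_complex : chainComplex R := restricted_complex C_subcomplex.

End Complexes.

(* Main.v *)
(* The non-strict multichains span a complement of [C] in [S], and this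
   complement is contracted by the operator [h] that doubles the first repeated
   entry of a multichain, with a suitable sign, and kills strict multichains.
   Thus [d h + h d = pi - 1], where [pi] discards the non-strict multichains.
   This identity alone shows that [pi] commutes with [d], so that [pi] is a
   chain map from [S] to [C]; it is inverse to the inclusion up to [h]. *)

Require Import Defs.
From HB Require Import structures.
From mathcomp Require Import all_boot all_order all_algebra.
From mathcomp Require Import finmap boolp classical_sets cardinality.

Set Implicit Arguments.
Unset Strict Implicit.
Unset Printing Implicit Defensive.

Import Order.TTheory GRing.Theory.

Local Open Scope ring_scope.

(** * Alternating omissions and doublings on raw sequences *)

Section SequenceSums.
Variables (T : eqType) (V : zmodType).
Implicit Types (G : seq T -> V) (x y : T) (s t : seq T).

(** Recursion on the first entry matches that of [double_first]; the closed form, an alternating sum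
    over omitted positions, is [alt_omitE]. *)
Fixpoint alt_omit G t : V :=
  if t is y :: t' then G t' - alt_omit (fun s => G (y :: s)) t' else 0.

(* For a multichain [x t] whose first repetition is [x_i = x_(i+1)] (from
   [i = 1]), this is [(-1) ^ i] times [G] at the tail of the multichain obtained
   by inserting a third copy of [x_i]; it is [0] if [x t] is strict. *)
Fixpoint double_first G x t : V :=
  if t is y :: t' then
    if x == y then - G (y :: t) else - double_first (fun s => G (y :: s)) y t'
  else 0.

Lemma alt_omitN G t : alt_omit (fun s => - G s) t = - alt_omit G t.
Proof.
elim: t G => [|y t IH] G /=; first by rewrite oppr0.
by rewrite IH opprB opprK addrC.
Qed.

Lemma double_firstB G G' x t :
  double_first (fun s => G s - G' s) x t
  = double_first G x t - double_first G' x t.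
Proof.
elim: t G G' x => [|y t IH] G G' x /=; first by rewrite subr0.
by case: eqP => _; rewrite ?IH opprB opprK addrC.
Qed.

(** After doubling, the tail starts with two copies of [x], and omitting either gives equal terms of
    opposite sign. Later omissions cancel against the doublings of the faces that keep the
    repetition; only the face without it survives. *)
Lemma double_alt_repeat G x t :
  double_first (alt_omit G) x (x :: t) + alt_omit (double_first G x) (x :: t)
  = double_first G x t.
Proof.
rewrite /= eqxx alt_omitN !opprB opprK [X in X + _]addrAC subrr add0r.
by rewrite addrCA addNr addr0.
Qed.

(** Splitting off the terms that omit [y] leaves the same expression one entry later, ready for
    induction. *)
Lemma double_alt_cons G x y t : x != y ->
  double_first (alt_omit G) x (y :: t) + alt_omit (double_first G x) (y :: t)
  = double_first G x t - double_first G y t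
    + (double_first (alt_omit (fun s => G (y :: s))) y t
       + alt_omit (double_first (fun s => G (y :: s)) y) t).
Proof.
move=> /negPf xny; rewrite /= xny double_firstB alt_omitN opprK opprB.
by rewrite addrACA [RHS]addrACA [X in X + _ = _]addrC.
Qed.

End SequenceSums.

Lemma alt_omitE (R : pzRingType) (T : eqType) (V : lmodType R)
    (G : seq T -> V) (t : seq T) :
  alt_omit G t = \sum_(i < size t) (-1) ^+ i *: G (seq_omit i t).
Proof.
elim: t G => [|y t IH] G /=; first by rewrite big_ord0.
rewrite big_ord_recl expr0 scale1r seq_omit0 IH -sumrN; congr (_ + _).
by apply: eq_bigr => i _; rewrite /= /bump leq0n exprD expr1 mulN1r scaleNr.
Qed.

Lemma raddf_double_first (T : eqType) (V W : zmodType) (f : {additive V -> W})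
    (G : seq T -> V) x t :
  f (double_first G x t) = double_first (f \o G) x t.
Proof.
elim: t G x => [|y t IH] G x /=; first exact: raddf0.
by case: eqP => _; rewrite raddfN ?IH.
Qed.

Lemma double_first_is_linear (R : pzRingType) (T : eqType) (U V : lmodType R)
    (G : U -> seq T -> V) x t : (forall s, linear (G^~ s)) ->
  linear (fun u => double_first (G u) x t).
Proof.
move=> Glin r u v; elim: t G Glin x => [|y t IH] G Glin x /=.
  by rewrite scaler0 addr0.
case: eqP => _; first by rewrite Glin opprD scalerN.
have E := IH (fun u s => G u (y :: s)) (fun s => Glin (y :: s)) y.
by rewrite E opprD scalerN.
Qed.

(** * The homotopy identity on monotone sequences *)

Section Poset.
Variables (disp : Order.disp_t) (P : porderType disp) (V : zmodType).
Implicit Types (G : seq P -> V) (x y : P) (s t : seq P).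

(** Repeating an entry keeps a sequence monotone and inside [p], so [G] is evaluated only at such
    sequences. This allows substituting [S_dS_elt], which is valid only there. *)
Lemma eq_double_first (p : pred P) G G' x t :
  (forall s, size s = (size t).+1 -> path <=%O x s -> all p s -> G s = G' s) ->
  path <=%O x t -> all p t -> double_first G x t = double_first G' x t.
Proof.
elim: t G G' x => [|y t IH] G G' x //= GG' /andP[xy yt] /andP[py pt].
case: eqP => _; first by rewrite GG' //= ?lexx ?xy ?yt ?py ?pt.
congr (- _); apply: IH => // s ss ys ps.
by rewrite GG' //= ?ss // ?xy // py.
Qed.

(* The faces of [x y t] other than the one omitting [x], which is treated
   separately because it also changes the coefficient. *)
Lemma double_first_alt_omit G x y t : path <=%O x (y :: t) ->
  double_first (alt_omit G) x (y :: t) + alt_omit (double_first G x) (y :: t)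
  = if x == y then double_first G x t
    else if path <%O y t then 0 else G (y :: t).
Proof.
elim: t G x y => [|z t IH] G x y; case: (eqVneq x y) => [<- _|xny].
- exact: double_alt_repeat.
- by rewrite double_alt_cons //= !(subr0, addr0).
- exact: double_alt_repeat.
move=> /and3P[xy yz zt]; rewrite double_alt_cons //.
(* By antisymmetry, omitting [y] cannot create a new repetition. *)
have xnz : x != z.
  by apply: contraNneq xny => xz; rewrite eq_le xy xz.
(* If [y = z], doubling [y] supplies [G (y :: y :: t)] and the rest cancels; otherwise the two terms
   omitting [y] agree and cancel, leaving the induction hypothesis. *)
rewrite {}IH /= ?yz // (negPf xnz); case: (eqVneq y z) => [<-|ynz].
  by rewrite ltxx opprK addrAC addNr add0r.
by rewrite lt_neqAle ynz yz /= opprK addNr add0r.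
Qed.

End Poset.

(** Supports are finite, so each element is a finite sum of generators [dsum_inj (a i)]. *)
Lemma linear_dsum_ext (R : pzRingType) (I : choiceType) (M : I -> lmodType R)
    (N : lmodType R) (f g : {linear dsum M -> N}) :
  (forall i (v : M i), f (dsum_inj v) = g (dsum_inj v)) -> f =1 g.
Proof.
move=> fg a; pose A := fset_set [set i | a i != 0]%classic.
suff -> : a = \sum_(i <- A) dsum_inj (a i).
  by rewrite !linear_sum; apply: eq_bigr => i _.
have evalD j : {morph (fun b : dsum M => b j) : b c / b + c} by [].
apply: dsum_ext => j; rewrite (big_morph _ (evalD j) (dsum0E _ j)).
have [jA|jA] := boolP (j \in A); last first.
  rewrite dsum_suppE // big1_seq // => i /andP[_ iA].
  by rewrite dsum_inj_neq //; apply: contraNneq jA => <-.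
rewrite (big_fsetD1 j) // dsum_injE big1_seq => [|i]; first exact/esym/addr0.
by rewrite !inE => /andP[_ /andP[ij _]]; exact: dsum_inj_neq.
Qed.

(** * The differential in terms of raw sequences *)

Section Homotopy.
Variables (R : comPzRingType) (P : colouredPoset R).
Local Notation F := (cp_functor P).

(* The element [v x s] of [S_sum P k], or [0] if [x s] is not a multichain of
   [k + 1] terms different from [\top]. *)
Definition S_elt k (x : P) (v : F x) (s : seq P) : S_sum P k :=
  if insub s is Some t then
    if @idP (is_mchain (x, t : k.-tuple P)) is ReflectT p
    then dsum_inj (i := MChain p) (v : mc_colour (MChain p)) else 0
  else 0.

Lemma S_elt_inj k (c : mchain P k) (v : mc_colour c) :
  S_elt k v (mc_tail c) = dsum_inj v.
Proof.
case: c v => -[x t] p v; rewrite /S_elt valK.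
by case: {-}_ / idP => // p'; rewrite (bool_irrelevance p' p).
Qed.

Lemma S_elt_linear k x s : linear (fun v : F x => S_elt k v s).
Proof.
move=> r u v; rewrite /S_elt; case: insubP => [t _ _|_].
  case: {-}_ / idP => p; last by rewrite scaler0 addr0.
  exact: (linearP (@dsum_inj R _ (@mc_colour R P k) (MChain p))).
by rewrite scaler0 addr0.
Qed.

(** The default [0] off the order relation frees faces of raw sequences from carrying order
    proofs. *)
Definition pf_ext (x y : P) (v : F x) : F y :=
  if @idP (x <= y)%O is ReflectT xy then pf_map F xy v else 0.

Lemma pf_extE (x y : P) (xy : (x <= y)%O) (v : F x) :
  pf_ext y v = pf_map F xy v.
Proof.
by rewrite /pf_ext; case: {-}_ / idP => // xy'; rewrite (bool_irrelevance xy' xy).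
Qed.

Lemma pf_ext_id (x : P) (v : F x) : pf_ext x v = v.
Proof. by rewrite (pf_extE (lexx x)) pf_id. Qed.

Definition S_behead k (x : P) (v : F x) (s : seq P) : S_sum P k :=
  if s is y :: s' then S_elt k (pf_ext y v) s' else 0.

Lemma S_dS_injE k (c : mchain P k.+1) (v : mc_colour c) :
  S_dS P k (dsum_inj v)
  = S_behead k (v : F (mc_head c)) (mc_tail c)
    - alt_omit (S_elt k (v : F (mc_head c))) (mc_tail c).
Proof.
rewrite S_dS_inj /S_face; congr (_ - _).
  have := S_elt_inj (pf_map F (mc_head_le c) v : mc_colour (mc_behead c)).
  move=> <-; rewrite -(pf_extE (mc_head_le c)).
  by case: c v => -[x t] p; case/tupleP: t p.
rewrite alt_omitE size_tuple; apply: eq_bigr => i _.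
rewrite !exprS mulrA mulrNN !mul1r; congr (_ *: _).
exact/esym/(S_elt_inj (v : mc_colour (mc_omit c i))).
Qed.

Lemma S_dS_elt k (x : P) (v : F x) (s : seq P) : size s = k.+1 ->
  path <=%O x s -> all (fun y => y != \top%O) (x :: s) ->
  S_dS P k (S_elt k.+1 v s) = S_behead k v s - alt_omit (S_elt k v) s.
Proof.
move=> /eqP sk xs ns.
have p : is_mchain (x, Tuple sk) by rewrite /is_mchain /= xs.
by rewrite -(S_dS_injE (v : mc_colour (MChain p))) -S_elt_inj.
Qed.

(** * The doubling homotopy on multichains *)

Definition S_homotopy_inj k (c : mchain P k) (v : mc_colour c) : S_sum P k.+1 :=
  double_first (S_elt k.+1 (v : F (mc_head c))) (mc_head c) (mc_tail c).

Fact S_homotopy_inj_is_linear k (c : mchain P k) : linear (@S_homotopy_inj k c).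
Proof. by apply: double_first_is_linear => s; exact: S_elt_linear. Qed.
HB.instance Definition _ k (c : mchain P k) :=
  GRing.isLinear.Build R (mc_colour c) (S_sum P k.+1) *:%R (@S_homotopy_inj k c)
    (@S_homotopy_inj_is_linear k c).

Definition S_homotopy k : {linear S_sum P k -> S_sum P k.+1} :=
  dsum_lift (@S_homotopy_inj k : forall c, {linear mc_colour c -> S_sum P k.+1}).

Lemma S_homotopyE k (c : mchain P k) (v : mc_colour c) :
  S_homotopy k (dsum_inj v)
  = double_first (S_elt k.+1 (v : F (mc_head c))) (mc_head c) (mc_tail c).
Proof. exact: dsum_lift_inj. Qed.

Lemma S_homotopy_d k (c : mchain P k.+1) (v : mc_colour c) :
  S_dS P k.+1 (S_homotopy k.+1 (dsum_inj v)) + S_homotopy k (S_dS P k (dsum_inj v))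
  = if mc_strict c then 0 else - dsum_inj v.
Proof.
have Ehd : S_homotopy k (S_dS P k (dsum_inj v))
    = double_first (S_elt k.+1 (pf_ext (mc_head (mc_behead c)) v))
        (mc_head (mc_behead c)) (mc_tail (mc_behead c))
      - alt_omit (double_first (S_elt k.+1 (v : F (mc_head c))) (mc_head c)) (mc_tail c).
  rewrite S_dS_inj /S_face (linearB (S_homotopy k)) S_homotopyE -pf_extE (linear_sum (S_homotopy k)).
  rewrite alt_omitE size_tuple; congr (_ - _); apply: eq_bigr => i _.
  by rewrite !exprS mulrA mulrNN !mul1r (linearZZ (S_homotopy k)) S_homotopyE.
rewrite {}Ehd S_homotopyE raddf_double_first.
have /andP[pc nc] := mchain_valP c.
rewrite (@eq_double_first _ _ _ (fun y => y != \top%O) _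
  (fun s => S_behead k.+1 (v : F (mc_head c)) s
    - alt_omit (S_elt k.+1 (v : F (mc_head c))) s)) //; first last.
- by case/andP: nc.
- move=> s ss xs ns; apply: S_dS_elt => //=; first by rewrite ss size_tuple.
  by rewrite ns andbT; case/andP: nc.
rewrite double_firstB -(S_elt_inj v).
case: c v pc nc => -[x t]; case/tupleP: t => y t p v pc nc.
have key := @double_first_alt_omit _ P _ (S_elt k.+1 (v : F x)) x y t pc.
(* The two terms omitting the first entry, whose coefficient is transported, are grouped apart from
   those governed by [key]. *)
rewrite addrACA -opprD [X in _ - X]key /mc_strict /mc_head /mc_tail /= theadE.
have /andP[xy _] := pc; rewrite lt_neqAle xy andbT.
(* If [x != y], the transported terms cancel each other. If [x = y], transport is the identity and
   one of them cancels the value given by [key]. *)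
have [xy'|xny] /= := eqVneq x y; last first.
  by rewrite addNr sub0r; case: ifP => _; rewrite ?oppr0.
by subst y; rewrite pf_ext_id addrK.
Qed.

(** A multichain in [mchain P 0] has a single term, hence no repetition. *)
Lemma S_homotopy0 (a : S_sum P 0) : S_homotopy 0 a = 0.
Proof.
have -> : 0 = (\0 : {linear S_sum P 0 -> S_sum P 1}) a by [].
apply: linear_dsum_ext a => c v.
by rewrite S_homotopyE (size0nil (size_tuple _)).
Qed.

(** * The projection onto strict multichains *)

Fact strict_part_fin k (a : S_sum P k) :
  finite_set [set c | (if mc_strict c then a c else 0) != 0]%classic.
Proof.
apply: sub_finite_set (dsum_fin a) => c /=.
by case: ifP => // _; rewrite eqxx.
Qed.

Definition strict_part_fun k (a : S_sum P k) : S_sum P k :=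
  DSum (strict_part_fin a).

Fact strict_part_is_linear k : linear (@strict_part_fun k).
Proof.
move=> r a b; apply: dsum_ext => c; rewrite dsumDE dsumZE /=.
by case: ifP => // _; rewrite scaler0 addr0.
Qed.
HB.instance Definition _ k :=
  GRing.isLinear.Build R (S_sum P k) (S_sum P k) *:%R (@strict_part_fun k)
    (@strict_part_is_linear k).

Definition strict_part k : {linear S_sum P k -> S_sum P k} :=
  @strict_part_fun k.

Lemma strict_part_inj k (c : mchain P k) (v : mc_colour c) :
  strict_part k (dsum_inj v) = if mc_strict c then dsum_inj v else 0.
Proof.
apply: dsum_ext => c'.
transitivity (if mc_strict c' then dsum_inj v c' else 0); first by [].
have [<-|cc'] := eqVneq c c'; first by case: ifP.
by rewrite dsum_inj_neq // if_same; case: ifP => _; rewrite ?dsum_inj_neq.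
Qed.

Lemma strict_part_homotopy k (a : S_sum P k.+1) :
  strict_part k.+1 a - a
  = S_dS P k.+1 (S_homotopy k.+1 a) + S_homotopy k (S_dS P k a).
Proof.
pose f : {linear S_sum P k.+1 -> S_sum P k.+1} := strict_part k.+1 \- idfun.
pose g : {linear S_sum P k.+1 -> S_sum P k.+1} :=
  (S_dS P k.+1 \o S_homotopy k.+1) \+ (S_homotopy k \o S_dS P k).
apply: (@linear_dsum_ext _ _ _ _ f g) => c v.
rewrite [RHS]S_homotopy_d [LHS]/= strict_part_inj.
by case: ifP; rewrite ?subrr ?sub0r.
Qed.

Lemma strict_part0 (a : S_sum P 0) : strict_part 0 a = a.
Proof.
by apply: dsum_ext => c; rewrite /= /mc_strict (size0nil (size_tuple _)).
Qed.

(* Apply [d] to [pi = 1 + d h + h d] on one side and [d h d = (pi - 1) d] on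
   the other. *)
Lemma strict_part_d k (a : S_sum P k.+1) :
  strict_part k (S_dS P k a) = S_dS P k (strict_part k.+1 a).
Proof.
have -> : strict_part k.+1 a = a + S_dS P k.+1 (S_homotopy k.+1 a)
    + S_homotopy k (S_dS P k a).
  by rewrite -addrA -strict_part_homotopy addrC subrK.
rewrite !(linearD (S_dS P k)) S_dS_dS addr0.
(* [strict_part_homotopy] does not cover [S_sum P 0]; there the projection is the identity and the
   homotopy vanishes. *)
case: k a => [|k] a; first by rewrite strict_part0 S_homotopy0 linear0 addr0.
apply/eqP; rewrite addrC -subr_eq; apply/eqP.
by rewrite strict_part_homotopy S_dS_dS linear0 addr0.
Qed.

Lemma strict_part_supp k (a : S_sum P k) : strict_part k a \in @strict_supp _ P k.
Proof. by apply/asboolP => c /=; case: ifP => //; rewrite eqxx. Qed.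

Lemma strict_part_id k (a : S_sum P k) :
  a \in @strict_supp _ P k -> strict_part k a = a.
Proof.
move=> /asboolP sa; apply: dsum_ext => c /=; case: ifPn => // nc.
by apply/esym/eqP; apply: contraNT nc; exact: sa.
Qed.

(** * Chain maps and homotopy in all integer degrees *)

Definition normalise (k : int) : {linear S_complex P k -> S_complex P k} :=
  match k return {linear S_obj P k -> S_obj P k} with
  | Posz k.+1 => strict_part k
  | _ => idfun
  end.

Lemma normalise_d (k : int) (x : S_complex P (1 + k)) :
  normalise k (cc_d (S_complex P) k x) = cc_d (S_complex P) k (normalise (1 + k) x).
Proof.
case: k x => [[|k]|k] x; [|exact: strict_part_d|by rewrite [LHS]linear0].
by rewrite [normalise (1 + 0) x]strict_part0.
Qed.

Lemma normalise_pred (k : int) (x : S_complex P k) :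
  normalise k x \in @C_pred R P k.
Proof. by case: k x => [[|k]|k] x //; exact: strict_part_supp. Qed.

Lemma normalise_id (k : int) (x : S_complex P k) :
  x \in @C_pred R P k -> normalise k x = x.
Proof. by case: k x => [[|k]|k] x //; exact: strict_part_id. Qed.

Definition projection_fun (k : int) (x : S_complex P k) : C_complex P k :=
  @Submod R (S_complex P k) (@C_pred R P k) (@C_pred_closed R P k)
    (normalise k x) (normalise_pred x).

Fact projection_is_linear (k : int) : linear (@projection_fun k).
Proof. by move=> r x y; apply: val_inj; exact: linearP. Qed.
HB.instance Definition _ (k : int) :=
  GRing.isLinear.Build R (S_complex P k) (C_complex P k) *:%R
    (@projection_fun k) (@projection_is_linear k).

Fact projection_comm (k : int) (x : S_complex P (1 + k)) :
  projection_fun (cc_d (S_complex P) k x)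
  = cc_d (C_complex P) k (projection_fun x).
Proof. by apply: val_inj; exact: normalise_d. Qed.

Definition projection : chainMap (S_complex P) (C_complex P) :=
  @ChainMap R (S_complex P) (C_complex P) (fun k => @projection_fun k)
    projection_comm.

Definition inclusion_fun (k : int) (x : C_complex P k) : S_complex P k :=
  submod_val x.

Fact inclusion_is_linear (k : int) : linear (@inclusion_fun k).
Proof. by []. Qed.
HB.instance Definition _ (k : int) :=
  GRing.isLinear.Build R (C_complex P k) (S_complex P k) *:%R
    (@inclusion_fun k) (@inclusion_is_linear k).

Definition inclusion : chainMap (C_complex P) (S_complex P) :=
  @ChainMap R (C_complex P) (S_complex P) (fun k => @inclusion_fun k)
    (fun k x => erefl).

Definition S_complex_homotopy (k : int) :
    {linear S_complex P k -> S_complex P (1 + k)} :=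
  match k return {linear S_obj P k -> S_obj P (1 + k)} with
  | Posz k.+1 => S_homotopy k
  | _ => \0
  end.

Lemma normalise_homotopy (k : int) (x : S_complex P (1 + k)) :
  normalise (1 + k) x - x
  = cc_d (S_complex P) (1 + k) (S_complex_homotopy (1 + k) x)
    + S_complex_homotopy k (cc_d (S_complex P) k x).
Proof.
(* Splitting [Negz] too lets [1 + k] reduce: [Negz 0] leads to degree [0], the others stay below. *)
case: k x => [[|k]|[|k]] x; last 2 first.
- by rewrite [RHS]addr0 linear0 [LHS]subrr.
- by rewrite [RHS]addr0 linear0 [LHS]subrr.
- rewrite [RHS]addr0 [normalise (1 + 0) x]strict_part0 subrr.
  by rewrite [S_complex_homotopy _ _]S_homotopy0 linear0.
exact: strict_part_homotopy.
Qed.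

End Homotopy.

Theorem corollary1 (R : comPzRingType) (P : colouredPoset R) :
  homotopy_equivalent (C_complex P) (S_complex P).
Proof.
exists (inclusion P), (projection P); split.
  (* Projection after inclusion is exactly the identity, so the zero homotopy serves. *)
  exists (fun k => \0) => k x; rewrite /= linear0 addr0.
  apply/eqP; rewrite subr_eq0; apply/eqP/val_inj => /=.
  exact/normalise_id/submod_valP.
(* Inclusion after projection is [normalise]. *)
by exists (@S_complex_homotopy R P) => k x; exact: normalise_homotopy.
Qed.
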